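(* For every integer $t\ge 2$, there exists a $(12t+10,3,2)$-BIBD $(X,\mathcal{A})$ with a weak nesting $\phi:\mathcal{A}\to Y$, $X\subseteq Y$, where $|Y|=w=14t+13$.
   Context: A $(v,k,\lambda)$-BIBD is a pair $(X,\mathcal{A})$ where $X$ is a set of $v$ points and $\mathcal{A}$ is a multiset of $k$-subsets of $X$ (blocks) such that every pair of distinct points lies in exactly $\lambda$ blocks. A partial $(w,k,\lambda)$-BIBD is defined in the same way on $w$ points, except that every pair lies in at most $\lambda$ blocks. Given a $(v,k,\lambda)$-BIBD $(X,\mathcal{A})$ and a set $Y\supseteq X$ with $|Y|=w$, a map $\phi:\mathcal{A}\to Y$ is a weak nesting if $\phi(A)\notin A$ for every block $A$ and the multiset $\{A\cup\{\phi(A)\}:A\in\mathcal{A}\}$ is a partial $(w,k+1,\lambda+1)$-BIBD on $Y$. *)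

(* Defs.v *)
From mathcomp Require Import all_boot.
Set Implicit Arguments. Unset Strict Implicit. Unset Printing Implicit Defensive.

(* Blocks form a multiset, represented as a sequence of finite sets. *)

Definition pair_count (T : finType) (A : seq {set T}) (x y : T) : nat :=
  count (fun B : {set T} => (x \in B) && (y \in B)) A.

Definition is_BIBD (T : finType) (v k lam : nat) (X : {set T}) (A : seq {set T}) : Prop :=
  [/\ #|X| = v,
      all (fun B : {set T} => (B \subset X) && (#|B| == k)) A &
      forall x y, x \in X -> y \in X -> x != y -> pair_count A x y = lam].

Definition is_partial_BIBD (T : finType) (w k lam : nat) (Y : {set T}) (A : seq {set T}) : Prop :=
  [/\ #|Y| = w,
      all (fun B : {set T} => (B \subset Y) && (#|B| == k)) A &
      forall x y, x \in Y -> y \in Y -> x != y -> pair_count A x y <= lam].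

Definition is_weak_nesting (T : finType) (k lam : nat) (Y : {set T}) (A : seq {set T})
    (phi : 'I_(size A) -> T) : Prop :=
  [/\ forall i, phi i \in Y,
      forall i, phi i \notin nth set0 A i &
      is_partial_BIBD #|Y| k.+1 lam.+1 Y
        [seq phi i |: nth set0 A i | i <- enum 'I_(size A)]].
Arguments is_weak_nesting {T} k lam Y A phi.

(* Main.v *)
Require Import Defs.
From mathcomp Require Import all_boot all_algebra zify.
Set Implicit Arguments. Unset Strict Implicit. Unset Printing Implicit Defensive.
Import GRing.Theory Num.Theory.

(** Let [m = 2h + 1] be coprime to 3 and consider points [x_i] with [x] in Z/m and [i] in Z/3.
For [d = 1, ..., h] and [i] in Z/3 take the base blocks [{d_i, (-d)_i, (2d)_{i+1}}], nested
with [0_{i+1}], and [{d_i, (-d)_i, (-2d)_{i+1}}], nested with an infinite point [oo_d].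
Every difference involved is [s * d] with [s] one of 1, 2, 3 up to sign, hence [s] is a unit,
and developing over Z/m yields a 3-GDD of type [3^m] and index 2 with a weak nesting.
To get a BIBD, add [c] fixed points and replace the blocks of the first [k] values of [d] by
finitely many base blocks with integer coordinates; that these have the required differences
is an equality of multisets of integers, independent of [m] and checked by computation.
If 3 does not divide [t], use [m = 4t + 3], [c = 1], [k = 1]; otherwise use [m = 4t + 1],
[c = 7], [k = 5], with two Fano planes on the fixed points. *)

(* [inl (i, z)] is the point of residue [z] in fibre [i]; [inr j] is fixed by the development. *)
Definition bpoint := ('I_3 * int + nat)%type.

(* A base block together with the point it is nested with. *)
Definition nblock := (bpoint * seq bpoint)%type.

Definition aug (q : nblock) : seq bpoint := q.1 :: q.2.

Definition coords (i : 'I_3) (B : seq bpoint) : seq int :=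
  pmap (fun b => if b is inl c then (if c.1 == i then Some c.2 else None) else None) B.

Definition diffs (i j : 'I_3) (B : seq bpoint) : seq int :=
  [seq z' - z | z <- coords i B, z' <- coords j B]%R.

Definition fixeds (B : seq bpoint) : seq nat :=
  pmap (fun b => if b is inr j then Some j else None) B.

(** * Developing base blocks: the method of differences *)

Section Develop.
Variables (R : finNzRingType) (N : nat).
Local Open Scope ring_scope.

Definition point := ('I_3 * R + 'I_N.+1)%type.

Definition place (g : R) (b : bpoint) : point :=
  match b with
  | inl c => inl (c.1, c.2%:~R + g)
  | inr j => inr (inord j)
  end.

Definition block (g : R) (B : seq bpoint) : {set point} := [set x in map (place g) B].

(** Distinctness is tested at the translate 0 only, because translations permute the points. The
    bound keeps [inord], which sends indices above [N] to a default value, from merging fixed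
    points. *)
Definition placeable (B : seq bpoint) : bool :=
  uniq (map (place 0) B) && all (ltn^~ N.+1) (fixeds B).

Lemma place_uniq g B : placeable B -> uniq (map (place g) B).
Proof.
case/andP=> u _.
pose sh (x : point) : point := if x is inl c then inl (c.1, c.2 + g) else x.
have sh_inj : injective sh.
  by move=> [[i a]|j] [[i' a']|j'] //= [-> /addIr ->].
have -> : map (place g) B = map sh (map (place 0) B).
  by rewrite -map_comp; apply: eq_map => -[[i z]|j] //=; rewrite addr0.
by rewrite map_inj_uniq.
Qed.

(** The placed points being distinct, membership is a sum of indicators; pair counts become double
    sums that can be exchanged with the sum over translations. *)
Lemma mem_block g B x : placeable B ->
  (x \in block g B) = (\sum_(b <- B) (place g b == x))%N :> nat.
Proof.
move=> pB; rewrite inE -(count_uniq_mem _ (place_uniq g pB)) count_map.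
by rewrite -sum1_count big_mkcond.
Qed.

Lemma sum_coords i B (F : int -> nat) :
  (\sum_(z <- coords i B) F z
   = \sum_(b <- B) (if b is inl c then (c.1 == i) * F c.2 else 0))%N.
Proof.
rewrite big_pmap; apply: eq_bigr => -[[i' z]|j] _ //=.
by case: eqP => //= _; rewrite mul1n.
Qed.

Lemma size_coords i B :
  size (coords i B) = (\sum_(b <- B) (if b is inl c then (c.1 == i : nat) else 0))%N.
Proof.
rewrite -sum1_size sum_coords; apply: eq_bigr => -[[i' z]|j] _ //=.
by rewrite muln1.
Qed.

Lemma mem_block_fixed g B (j : 'I_N.+1) : placeable B ->
  (inr j \in block g B) = (val j \in fixeds B).
Proof.
case/andP=> _ /allP ltN; rewrite inE.
apply/mapP/idP => [[[c|n] // nB [->]]|].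
  have nF : n \in fixeds B by rewrite mem_pmap; apply/mapP; exists (inr n).
  by rewrite /= inordK //; apply: ltN.
rewrite mem_pmap => /mapP[[c|n] // nB [jn]].
by exists (inr n) => //=; rewrite -jn inord_val.
Qed.

Lemma pair_count_block g B x y : placeable B ->
  ((x \in block g B) && (y \in block g B) : nat) =
  (\sum_(p <- B) \sum_(q <- B) (place g p == x) * (place g q == y))%N.
Proof.
move=> pB; rewrite -mulnb !mem_block // big_distrl /=.
by apply: eq_bigr => p _; rewrite big_distrr.
Qed.

Definition dev_count B (x y : point) : nat :=
  (\sum_g ((x \in block g B) && (y \in block g B) : nat))%N.

(** Exactly one translation, [a - z], carries [z] to [a]. *)
Lemma sum_shift (a z : R) (F : R -> nat) :
  (\sum_g ((z + g)%R == a) * F g)%N = F (a - z).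
Proof.
rewrite (bigD1 (a - z)) //= addrCA subrr addr0 eqxx mul1n big1 ?addn0 // => g ne.
by rewrite addrC eq_sym -subr_eq eq_sym (negbTE ne).
Qed.

(** Entries [z] and [z'] reach [a] and [b] under a common translation only if it is [a - z], and
    then [z' - z] has residue [b - a]. *)
Lemma dev_count_fibres B i j (a b : R) : placeable B ->
  dev_count B (inl (i, a)) (inl (j, b))
  = count (fun z : int => z%:~R == b - a) (diffs i j B).
Proof.
move=> pB; rewrite /dev_count (eq_bigr _ (fun g _ => pair_count_block g _ _ pB)).
rewrite exchange_big /= -sum1_count [RHS]big_mkcond big_allpairs_dep /= sum_coords.
apply: eq_bigr => -[[i' z]|n] _ /=; last first.
  by rewrite big1 // => g _; rewrite big1.
rewrite exchange_big /= sum_coords big_distrr /=.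
apply: eq_bigr => -[[j' z']|n] _ /=; last first.
  by rewrite muln0 big1 // => g _; rewrite muln0.
transitivity ((i' == i) * ((j' == j) * ((z'%:~R + (a - z%:~R))%R == b)))%N.
  rewrite -(sum_shift a z%:~R (fun g => (j' == j) * ((z'%:~R + g)%R == b))%N) big_distrr /=.
  by apply: eq_bigr => g _; rewrite mulnA !mulnb.
do 2!congr (_ * _)%N.
by rewrite rmorphB /= addrA addrAC eq_sym -subr_eq eq_sym; case: ifP.
Qed.

(** All translates contain [j] or none does, and each entry in fibre [i] reaches [a] under exactly
    one translation. *)
Lemma dev_count_fixed B i a (j : 'I_N.+1) : placeable B ->
  dev_count B (inl (i, a)) (inr j) = ((val j \in fixeds B) * size (coords i B))%N.
Proof.
move=> pB; rewrite /dev_count.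
under eq_bigr => g _ do rewrite mem_block_fixed // andbC -mulnb mem_block //.
rewrite -big_distrr /= exchange_big size_coords; congr (_ * _)%N.
apply: eq_bigr => -[[i' z]|n] _ /=; last by rewrite big1.
rewrite -[RHS](sum_shift a z%:~R (fun=> (i' == i) : nat)).
by apply: eq_bigr => g _; rewrite mulnb andbC.
Qed.

Lemma dev_count_fixed2 B (j j' : 'I_N.+1) : placeable B -> j != j' ->
  (size (fixeds B) <= 1)%N -> dev_count B (inr j) (inr j') = 0%N.
Proof.
move=> pB ne; rewrite /dev_count => le1; apply: big1 => g _.
rewrite !mem_block_fixed //; case: (fixeds B) le1 => [|n [|]] // _.
rewrite !inE; apply/eqP; rewrite eqb0; apply: contra ne => /andP[/eqP jn /eqP j'n].
by rewrite -val_eqE jn j'n.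
Qed.

End Develop.
Arguments placeable : clear implicits.

(** * Weak nestings of developed designs *)

Lemma pair_countC (T : finType) (A : seq {set T}) x y : pair_count A x y = pair_count A y x.
Proof. by apply: eq_count => B; rewrite andbC. Qed.

(** Constructions are easier on a list of pairs of a nesting point and a block; [phi] reads the
    first component at the same position, so repeated blocks may receive different points. *)
Lemma weak_nesting_unzip2 (T : finType) k lam (Y : {set T}) (W : seq (T * {set T})) :
  (forall w, w \in W -> (w.1 \in Y) && (w.1 \notin w.2)) ->
  is_partial_BIBD #|Y| k.+1 lam.+1 Y [seq w.1 |: w.2 | w <- W] ->
  exists phi, is_weak_nesting k lam Y (unzip2 W) phi.
Proof.
move=> Wok pB.
pose w (i : 'I_(size (unzip2 W))) := tnth (in_tuple W) (cast_ord (size_map _ _) i).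
have nthE (i : 'I_(size (unzip2 W))) : nth set0 (unzip2 W) i = (w i).2.
  rewrite (nth_map (w i)); first by rewrite {2}/w (tnth_nth (w i)).
  by rewrite -(size_map snd W).
have wW i : w i \in W by apply: mem_tnth.
exists (fun i => (w i).1); split=> [i|i|].
- by case/andP: (Wok _ (wW i)).
- by rewrite nthE; case/andP: (Wok _ (wW i)).
suff -> : [seq (w i).1 |: nth set0 (unzip2 W) i | i <- enum 'I_(size (unzip2 W))]
          = [seq w.1 |: w.2 | w <- W] by [].
apply: (@eq_from_nth _ set0); first by rewrite size_map size_enum_ord !size_map.
move=> n; rewrite size_map size_enum_ord => ltn.
rewrite (nth_map (Ordinal ltn)) ?size_enum_ord // nthE.
rewrite (_ : nth _ _ _ = Ordinal ltn); last by apply: val_inj; rewrite /= nth_enum_ord.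
have ltnW : n < size W by rewrite -(size_map snd).
rewrite [RHS](nth_map (w (Ordinal ltn))) //.
rewrite [in RHS](_ : nth _ _ _ = w (Ordinal ltn)) // {2}/w.
by rewrite (tnth_nth (w (Ordinal ltn))).
Qed.

Section Nesting.
Variables (R : finNzRingType) (N : nat).
Local Open Scope ring_scope.
Notation point := (point R N).

(** The blocks of [P] will consist of fixed points only: their translates all coincide, and one copy
    is taken. *)
Definition develop (Q P : seq (seq bpoint)) : seq {set point} :=
  [seq block N g B | B <- Q, g <- enum R] ++ [seq block N (0 : R)%R B | B <- P].

Lemma pair_count_develop Q P x y :
  pair_count (develop Q P) x y
  = (\sum_(B <- Q) dev_count B x y
     + count (fun B => (x \in block N (0 : R)%R B) && (y \in block N (0 : R)%R B)) P)%N.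
Proof.
rewrite /pair_count count_cat count_map; congr (_ + _)%N.
rewrite -sum1_count big_mkcond big_allpairs_dep; apply: eq_bigr => B _.
by rewrite big_enum; apply: eq_bigr => g _; case: (_ && _).
Qed.

(** Pairs with a fibre point are met only by [Q], pairs of fixed points only by [P]. The predicate
    [ok] will be equality to 2 for the blocks and the bound 3 for the augmented blocks; [S] selects
    the fixed points concerned, those of the design or all. *)
Lemma develop_pair_count (ok S : pred nat) (Q P : seq (seq bpoint)) :
  (forall B, B \in Q ++ P -> placeable R N B) ->
  (forall B, B \in Q -> size (fixeds B) <= 1)%N ->
  (forall B i, B \in P -> coords i B = [::]) ->
  (forall i j (d : R), (i == j) ==> (d != 0) ->
     ok (\sum_(B <- Q) count (fun z : int => z%:~R == d) (diffs i j B))%N) ->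
  (forall i j, S j -> (j <= N)%N ->
     ok (\sum_(B <- Q) (j \in fixeds B) * size (coords i B))%N) ->
  (forall j j', S j -> S j' -> (j <= N)%N -> (j' <= N)%N -> j != j' ->
     ok (count (fun B => (j \in fixeds B) && (j' \in fixeds B)) P)) ->
  forall x y : point, x != y ->
    (if x is inr j then S j else true) -> (if y is inr j then S j else true) ->
    ok (pair_count (develop Q P) x y).
Proof.
move=> pQP Q1 P0 okD okC okF x y ne Sx Sy.
have pQ B : B \in Q -> placeable R N B by move=> BQ; rewrite pQP // mem_cat BQ.
have pP B : B \in P -> placeable R N B by move=> BP; rewrite pQP // mem_cat BP orbT.
have noP u B : B \in P -> inl u \in block N (0 : R)%R B = false.
  case: u => i a BP; apply/negbTE/negP; rewrite inE => /mapP[[c|//] cB [ei _]].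
  have: c.2 \in coords i B by rewrite mem_pmap; apply/mapP; exists (inl c); rewrite //= ei eqxx.
  by rewrite P0.
have noPc u y' :
    count (fun B => (inl u \in block N (0 : R)%R B) && (y' \in block N (0 : R)%R B)) P = 0%N.
  by apply/eqP; rewrite -leqn0 leqNgt -has_count; apply/hasPn => B /(noP u)->.
have mixed u (j : 'I_N.+1) : S j ->
    ok (pair_count (develop Q P) (inl u) (inr j)).
  case: u => i a Sj; rewrite pair_count_develop noPc addn0 big_seq.
  under eq_bigr => B /pQ pB do rewrite dev_count_fixed //.
  by rewrite -big_seq; apply: okC => //; apply: leq_ord.
case: x y Sx Sy ne => [u|j] [u'|j'] Sx Sy ne; last first.
- rewrite pair_count_develop big_seq big1 => [|B BQ].
    rewrite add0n (@eq_in_count _ _ (fun B => (val j \in fixeds B) && (val j' \in fixeds B))).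
      by apply: okF => //; apply: leq_ord.
    by move=> B /pP pB /=; rewrite !mem_block_fixed.
  by rewrite dev_count_fixed2 ?pQ ?Q1.
- by rewrite pair_countC; apply: mixed.
- exact: mixed.
case: u u' Sx Sy ne => [i a] [i' a'] _ _ ne; rewrite pair_count_develop noPc addn0 big_seq.
under eq_bigr => B /pQ pB do rewrite dev_count_fibres //.
rewrite -big_seq; apply: okD; apply/implyP => /eqP ii'.
by apply: contra ne; rewrite subr_eq0 ii' => /eqP->.
Qed.

End Nesting.

Section Existence.
Variables (R : finNzRingType) (N : nat).
Local Open Scope ring_scope.
Notation point := (point R N).

Definition nested_develop (Q P : seq nblock) : seq (point * {set point}) :=
  [seq (place N g q.1, block N g q.2) | q <- Q, g <- enum R]
  ++ [seq (place N 0 q.1, block N 0 q.2) | q <- P].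

Lemma unzip2_nested_develop Q P :
  unzip2 (nested_develop Q P) = develop R N (unzip2 Q) (unzip2 P).
Proof.
rewrite /unzip2 map_cat map_allpairs -map_comp /develop allpairs_mapl.
by rewrite -[in RHS]map_comp.
Qed.

Lemma block_aug (g : R) q : block N g (aug q) = place N g q.1 |: block N g q.2 :> {set point}.
Proof. by apply/setP => x; rewrite !inE. Qed.

Lemma aug_nested_develop Q P :
  [seq w.1 |: w.2 | w <- nested_develop Q P] = develop R N (map aug Q) (map aug P).
Proof.
rewrite map_cat map_allpairs -map_comp /develop allpairs_mapl -[in RHS]map_comp.
congr (_ ++ _); last by apply: eq_map => q /=; rewrite block_aug.
by congr flatten; apply: eq_map => q; apply: eq_map => g; rewrite block_aug.
Qed.

Lemma mem_nested_develop Q P w : w \in nested_develop Q P ->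
  exists2 q, q \in Q ++ P & exists g, w = (place N g q.1, block N g q.2).
Proof.
rewrite mem_cat => /orP[/allpairsP[[q g] [/= qQ _ ->]]|/mapP[q qP ->]].
  by exists q; [rewrite mem_cat qQ | exists g].
by exists q; [rewrite mem_cat qP orbT | exists 0].
Qed.

Lemma card_block (g : R) B : placeable R N B -> #|block N g B| = size B.
Proof.
move=> pB; rewrite /block (eq_card (_ : _ =i map (place N g) B)); last by move=> x; rewrite inE.
by rewrite (card_uniqP _) ?size_map //; apply: place_uniq.
Qed.

Definition finite_points c : {set point} := [set x | if x is inr j then val j < c else true]%N.

Lemma card_finite_points c : (c <= N.+1)%N -> #|finite_points c| = (3 * #|R| + c)%N.
Proof.
move=> cN; rewrite -sum1_card big_mkcond big_sumType /=; congr (_ + _)%N.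
  under eq_bigr => u _ do rewrite inE.
  by rewrite sum1_card card_prod card_ord.
under eq_bigr => j _ do rewrite inE.
by rewrite -big_mkcond (big_ord_narrow cN) sum1_card card_ord.
Qed.

Lemma develop_nesting c (Q P : seq nblock) :
  (c <= N.+1)%N ->
  (forall q, q \in Q ++ P ->
     [/\ placeable R N (aug q), size q.2 = 3 & all (ltn^~ c) (fixeds q.2)]) ->
  (forall q, q \in Q -> size (fixeds (aug q)) <= 1)%N ->
  (forall q i, q \in P -> coords i (aug q) = [::]) ->
  (forall (i j : 'I_3) (d : R), (i == j) ==> (d != 0%R) ->
     \sum_(q <- Q) count (fun z : int => z%:~R == d) (diffs i j q.2) = 2)%N ->
  (forall (i j : 'I_3) (d : R), (i == j) ==> (d != 0%R) ->
     \sum_(q <- Q) count (fun z : int => z%:~R == d) (diffs i j (aug q)) <= 3)%N ->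
  (forall i j, j < c ->
     \sum_(q <- Q) (j \in fixeds q.2) * size (coords i q.2) = 2)%N ->
  (forall i j, j <= N ->
     \sum_(q <- Q) (j \in fixeds (aug q)) * size (coords i (aug q)) <= 3)%N ->
  (forall j j', j < c -> j' < c -> j != j' ->
     count (fun q => (j \in fixeds q.2) && (j' \in fixeds q.2)) P = 2)%N ->
  (forall j j', j != j' ->
     count (fun q => (j \in fixeds (aug q)) && (j' \in fixeds (aug q))) P <= 3)%N ->
  exists (T : finType) (X Y : {set T}) (A : seq {set T}) (phi : 'I_(size A) -> T),
    [/\ X \subset Y, #|Y| = (3 * #|R| + N.+1)%N,
        is_BIBD (3 * #|R| + c) 3 2 X A & is_weak_nesting 3 2 Y A phi].
Proof.
move=> cN okQP Q1 P0 d2 d3 c2 c3 f2 f3.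
have pl2 q : q \in Q ++ P -> placeable R N q.2.
  case/okQP=> /andP[/=/andP[_ u] /allP fN] _ _; rewrite /placeable u.
  by apply/allP => j jq; apply: fN; case: q.1 => //= n; rewrite inE jq orbT.
pose X := finite_points c; pose Y : {set point} := [set: point].
have [phi nest] : exists phi, is_weak_nesting 3 2 Y (unzip2 (nested_develop Q P)) phi.
  apply: weak_nesting_unzip2 => [w /mem_nested_develop[q /okQP[pq _ _] [g ->]]|].
    rewrite inE /= inE; have := place_uniq g pq.
    by rewrite /= => /andP[].
  split=> // [|x y _ _ ne].
    apply/allP => _ /mapP[w /mem_nested_develop[q /okQP[pq s3 _] [g ->]] ->] /=.
    by rewrite subsetT -block_aug card_block //= s3.
  rewrite aug_nested_develop.
  apply: (@develop_pair_count _ _ (leq^~ 3) xpredT) => //; first 6 last.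
  - by case: x {ne}.
  - by case: y {ne}.
  - by rewrite -map_cat => _ /mapP[q /okQP[? _ _] ->].
  - by move=> _ /mapP[q /Q1 ? ->].
  - by move=> _ i /mapP[q /P0 ? ->].
  - by move=> i j d /d3; rewrite big_map.
  - by move=> i j _ /c3; rewrite big_map.
  - by move=> j j' _ _ _ _ /f3; rewrite count_map.
exists point, X, Y, (unzip2 (nested_develop Q P)), phi; split=> //.
- exact: subsetT.
- by rewrite /Y cardsT /point card_sum card_prod !card_ord.
split=> [||x y xX yX ne]; first exact: card_finite_points.
  apply/allP => _ /mapP[w /mem_nested_develop[q qQP [g ->]] ->] /=.
  have [_ s3 /allP fc] := okQP _ qQP.
  rewrite card_block ?s3 ?pl2 // andbT; apply/subsetP => -[u|j]; rewrite !inE //.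
  by rewrite -[_ \in _]inE mem_block_fixed ?pl2 //; apply: fc.
rewrite unzip2_nested_develop; apply/eqP.
apply: (@develop_pair_count _ _ (pred1 2) (ltn^~ c)) => //; first 6 last.
- by move: xX; rewrite inE.
- by move: yX; rewrite inE.
- by rewrite -map_cat => _ /mapP[q /pl2 ? ->].
- move=> _ /mapP[q /Q1 le1 ->]; apply: leq_trans le1.
  by rewrite /aug; case: q.1.
- move=> _ i /mapP[q /(P0 _ i) e ->]; move: e; rewrite /aug /=; case: q.1 => [u|] //=.
  by case: (_ == _).
- by move=> i j d /d2; rewrite big_map => /eqP.
- by move=> i j /c2 e _; rewrite big_map /= e.
- by move=> j j' /f2 e /e{}e _ _ /e; rewrite count_map => /eqP.
Qed.

End Existence.

(** * Multiples of small units modulo [m] *)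

Section Multiples.
Variables (h : nat).
Local Notation m := (h.*2.+1).
Hypotheses (h_gt0 : 0 < h) (m3 : ~~ (3 %| m)).
Local Open Scope ring_scope.
Local Notation R := ('Z_m).

(** The ring ['Z_m] has order [m] only when [m > 1], hence the assumption [0 < h]. *)
Lemma order_gt1 : (1 < m)%N. Proof. by rewrite ltnS double_gt0. Qed.

Lemma card_residues : #|R| = m. Proof. by rewrite card_ord Zp_cast ?order_gt1. Qed.

Lemma natr_eq (n n' : nat) : (n < m)%N -> (n' < m)%N -> (n%:R == n'%:R :> R) = (n == n').
Proof.
move=> ltn ltn'; apply/eqP/eqP => [e|-> //].
have := congr1 val e; rewrite /= !val_Zp_nat ?order_gt1 //.
by rewrite !modn_small.
Qed.

Lemma intr_inj_small (z : int) : (`|z| < m)%N -> z%:~R = 0 :> R -> z = 0.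
Proof.
case: z => n /= ltn.
  by rewrite -pmulrn => /eqP; rewrite -[0]/(0%:R) natr_eq // => /eqP ->.
rewrite NegzE mulrNz -pmulrn => /eqP; rewrite oppr_eq0 -[0]/(0%:R) natr_eq //.
Qed.

Lemma slope_unit (a : int) : a \in [:: 1; 2; 3] -> (a%:~R : R) \is a GRing.unit.
Proof.
have m2 : coprime m 2 by rewrite coprimen2 /= odd_double.
have m3' : coprime m 3 by rewrite coprime_sym prime_coprime.
by rewrite !inE => /or3P[] /eqP->; rewrite -[_%:~R]/(_%:R) unitZpE ?order_gt1 // coprimen1.
Qed.

(** As [m = 2h + 1], the residues of 1, ..., h and their negatives run once through the nonzero
    residues: [e] is met by [d = e] or by [d = m - e]. *)
Lemma half_system (e : R) :
  (\sum_(d <- iota 1 h) ((d%:R == e) + (- d%:R == e)) = (e != 0%R))%N.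
Proof.
have lte : (e < m)%N by rewrite -[X in (_ < X)%N](Zp_cast order_gt1) ltn_ord.
have eE : e = (e : nat)%:R by rewrite natr_Zp.
rewrite big_split /=.
have count1 (n : nat) : (\sum_(d <- iota 1 h) (d == n) = (0 < n <= h))%N.
  have -> : (0 < n <= h)%N = (n \in iota 1 h) by rewrite mem_iota add1n ltnS.
  by rewrite -count_uniq_mem ?iota_uniq // -sum1_count [RHS]big_mkcond.
rewrite (eq_big_seq (fun d : nat => (d == e) : nat)) => [|d]; last first.
  by rewrite mem_iota => ltd; rewrite {1}eE natr_eq //; lia.
rewrite [X in (_ + X)%N](eq_big_seq (fun d : nat => (d == m - e)%N : nat)) => [|d]; last first.
  rewrite mem_iota => ltd; have -> : - d%:R = (m - d)%:R :> R.
    by rewrite natrB ?pchar_Zp ?order_gt1 ?sub0r //; lia.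
  by rewrite {1}eE natr_eq; lia.
rewrite !count1; have -> : (e != 0) = (0 < e)%N by rewrite lt0n.
by lia.
Qed.

(** Multiplication by the unit [a] permutes the nonzero residues. *)
Lemma slope_half_system (a : int) (e : R) : a \in [:: 1; 2; 3] ->
  (\sum_(d <- iota 1 h) (((a * d%:Z)%:~R == e) + ((- a * d%:Z)%:~R == e)) = (e != 0%R))%N.
Proof.
move=> /slope_unit ua; pose e' := (a%:~R)^-1 * e.
have -> : (e != 0) = (e' != 0).
  by rewrite /e' -[X in _ = (_ != X)](mulr0 (a%:~R)^-1) (inj_eq (mulrI _)) ?unitrV.
rewrite -half_system; apply: eq_bigr => d _.
rewrite mulNr !mulrNz intrM -mulrN -pmulrn.
by rewrite !(can2_eq (mulKr ua) (mulVKr ua)).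
Qed.

End Multiples.

(** * The integer template, its multiples and their differences *)

Definition fib0 : 'I_3 := @Ordinal 3 0 isT.
Definition fib1 : 'I_3 := @Ordinal 3 1 isT.
Definition fib2 : 'I_3 := @Ordinal 3 2 isT.
Definition fibres := [:: fib0; fib1; fib2].

Lemma mem_fibres i : i \in fibres.
Proof. by case: i => [[|[|[|n]]] ltn]. Qed.

Section Family.
Local Open Scope ring_scope.

(* The base blocks for [d = 1]; [inst] multiplies coordinates by [d] and moves the infinite
point to [o + d]. *)
Definition template : seq nblock :=
  flatten [seq
    [:: (inl (ij.2, 0), [:: inl (ij.1, 1); inl (ij.1, -1); inl (ij.2, 2)]);
        (inr 0%N, [:: inl (ij.1, 1); inl (ij.1, -1); inl (ij.2, -2)])]
    | ij <- [:: (fib0, fib1); (fib1, fib2); (fib2, fib0)]].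

Definition inst (o d : nat) (b : bpoint) : bpoint :=
  match b with inl c => inl (c.1, c.2 * d%:Z) | inr n => inr (o + d + n)%N end.

Definition inst_block o d (q : nblock) : nblock := (inst o d q.1, map (inst o d) q.2).

Definition scaled_family o d : seq nblock := [seq inst_block o d q | q <- template].

(** Zero differences are treated apart: within a fibre they pair an entry with itself, across fibres
    they concern points of equal residue. *)
Definition nonzero (s : seq int) := [seq z <- s | z != 0].

Definition all_diffs (f : nblock -> seq bpoint) i j (Q : seq nblock) : seq int :=
  flatten [seq diffs i j (f q) | q <- Q].

Definition family_diffs f i j (ds : seq nat) : seq int :=
  flatten [seq [seq s * d%:Z | s <- nonzero (all_diffs f i j template)] | d <- ds].

Definition incidences (f : nblock -> seq bpoint) i (n : nat) (Q : seq nblock) : nat :=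
  sumn [seq (n \in fixeds (f q)) * size (coords i (f q)) | q <- Q]%N.

(* The [E] are developed, the [P] are not. The fixed points below [c] belong to the design, and
those from [c] on are infinite; [E] and [P] only use those below [u]. The bound 10 keeps
distinct points of a base block distinct modulo [m > 10]. *)
Definition admissible (c u k : nat) (E P : seq nblock) : bool :=
  [&& all (fun q => [&& uniq (aug q), size q.2 == 3%N, all (ltn^~ c) (fixeds q.2),
                        all (ltn^~ u) (fixeds (aug q)) &
                        all (fun i => all (fun z => `|z| <= 10)%N (diffs i i (aug q))) fibres])
          (E ++ P),
      all (fun q => size (fixeds (aug q)) <= 1)%N E,
      all (fun q => all (fun i => coords i (aug q) == [::]) fibres) P,
      all (fun i => all (fun j =>
        [&& perm_eq (nonzero (all_diffs snd i j E)) (family_diffs snd i j (iota 1 k)),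
            all (fun z : int => count_mem z (nonzero (all_diffs aug i j E))
                          <= count_mem z (family_diffs aug i j (iota 1 k)))%N
                (nonzero (all_diffs aug i j E)) &
            (i != j) ==> (count_mem 0 (all_diffs snd i j E) == 2%N)
                         && (count_mem (0%R : int) (all_diffs aug i j E) <= 3)%N]) fibres) fibres,
      all (fun i => all (fun n => incidences snd i n E == 2%N) (iota 0 c)
                    && all (fun n => incidences aug i n E <= 3)%N (iota 0 u)) fibres,
      all (fun n => all (fun n' => (n != n') ==>
        (count (fun q => (n \in fixeds q.2) && (n' \in fixeds q.2)) P == 2%N))
        (iota 0 c)) (iota 0 c) &
      all (fun n => all (fun n' => (n != n') ==>
        (count (fun q => (n \in fixeds (aug q)) && (n' \in fixeds (aug q))) P <= 3)%N)
        (iota 0 u)) (iota 0 u)].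

Lemma coords_inst o d i B :
  coords i (map (inst o d) B) = [seq s * d%:Z | s <- coords i B].
Proof. by elim: B => //= -[[i' s]|n] B IH //=; case: eqP => //= _; rewrite IH. Qed.

Lemma fixeds_inst o d B :
  fixeds (map (inst o d) B) = [seq (o + d + n)%N | n <- fixeds B].
Proof. by elim: B => //= -[[i' s]|n] B IH //=; rewrite IH. Qed.

Lemma diffs_inst o d i j B :
  diffs i j (map (inst o d) B) = [seq s * d%:Z | s <- diffs i j B].
Proof.
rewrite /diffs !coords_inst allpairs_mapl allpairs_mapr map_allpairs.
by congr flatten; apply: eq_map => z; apply: eq_map => z'; rewrite mulrBl.
Qed.

(** Leaving [f] abstract covers both the blocks ([snd]) and the augmented blocks ([aug]). *)
Lemma nonzero_all_diffs_family f o d i j :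
  (forall q, f (inst_block o d q) = map (inst o d) (f q)) ->
  (0 < d)%N ->
  nonzero (all_diffs f i j (scaled_family o d))
  = [seq s * d%:Z | s <- nonzero (all_diffs f i j template)].
Proof.
move=> fE d0; rewrite /all_diffs -map_comp.
rewrite (eq_map (_ : _ =1 map ( *%R^~ d%:Z) \o (diffs i j \o f))); last first.
  by move=> q /=; rewrite fE diffs_inst.
rewrite map_comp -map_flatten /nonzero filter_map; congr map.
by apply: eq_filter => s /=; rewrite mulf_eq0 negb_or andbC (_ : d%:Z != 0) ?eqxx // -lt0n.
Qed.

Lemma inst_inj o d : (0 < d)%N -> injective (inst o d).
Proof.
move=> d0 [[i s]|n] [[i' s']|n'] //= [].
  by move=> -> /(mulIf _) ->; rewrite // -lt0n.
by move/addnI->.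
Qed.

(** The differences within a fibre are 0 and 2 up to sign; since [2d <= 2h < m], scaling by [d]
    creates no collision modulo [m]. *)
Lemma template_ok : all (fun q =>
  [&& uniq (aug q), size q.2 == 3%N, fixeds q.2 == [::],
      fixeds (aug q) \in [:: [::]; [:: 0%N]] &
      all (fun i => all (fun z : int => (z == 0) || (z \in [:: 2; -2])) (diffs i i (aug q))) fibres])
  template.
Proof. by vm_compute. Qed.

(** The infinite point of a family thus meets every fibre point exactly 3 times, the maximum
    allowed. *)
Lemma template_incidences : all (fun i => incidences aug i 0 template == 3%N) fibres.
Proof. by vm_compute. Qed.

(** The nonzero entries are [n] unit slopes and their negatives, so that their multiples by 1, ...,
    h cover each nonzero residue [n] times. *)
Definition slopes_ok n (s : seq int) :=
  let A := [seq z <- s | 0 < z] in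
  [&& perm_eq (nonzero s) (A ++ map -%R A), all (mem [:: 1; 2; 3]) A & size A == n].

(** The values 2 and 3 are the index of the design and the bound for the nesting. Zero does not
    occur across fibres: pairs of equal residue form the groups of the GDD and are left to other
    blocks. *)
Lemma template_slopes : all (fun i => all (fun j =>
  [&& slopes_ok 2 (all_diffs snd i j template), slopes_ok 3 (all_diffs aug i j template),
      (i != j) ==> (0 \notin all_diffs snd i j template) &
      (i != j) ==> (0 \notin all_diffs aug i j template)])
  fibres) fibres.
Proof. by vm_compute. Qed.

Lemma all_diffs_cat f i j Q Q' : all_diffs f i j (Q ++ Q') = all_diffs f i j Q ++ all_diffs f i j Q'.
Proof. by rewrite /all_diffs map_cat flatten_cat. Qed.

Lemma sum_count_diffs f i j Q (a : pred int) :
  (\sum_(q <- Q) count a (diffs i j (f q)))%N = count a (all_diffs f i j Q).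
Proof. by rewrite /all_diffs count_flatten -map_comp sumnE big_map. Qed.

Lemma incidencesE f i n Q :
  (\sum_(q <- Q) (n \in fixeds (f q)) * size (coords i (f q)))%N = incidences f i n Q.
Proof. by rewrite /incidences sumnE big_map. Qed.

Lemma nonzero_all_diffs_tail f o ds i j :
  (forall d q, f (inst_block o d q) = map (inst o d) (f q)) -> all (ltn 0) ds ->
  nonzero (all_diffs f i j (flatten [seq scaled_family o d | d <- ds])) = family_diffs f i j ds.
Proof.
move=> fE; elim: ds => // d ds IH /andP[d0 /IH{}IH].
rewrite map_cons -[flatten (_ :: _)]/(scaled_family o d ++ flatten _).
by rewrite all_diffs_cat /nonzero filter_cat -!/(nonzero _) IH nonzero_all_diffs_family.
Qed.

Lemma zero_notin_tail f o ds i j :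
  (forall d q, f (inst_block o d q) = map (inst o d) (f q)) -> all (ltn 0) ds ->
  0 \notin all_diffs f i j template ->
  0 \notin all_diffs f i j (flatten [seq scaled_family o d | d <- ds]).
Proof.
move=> fE /allP ds0 nz; apply/flatten_mapP => -[_ /flatten_mapP[d /ds0 d0 /mapP[q qT ->]]].
rewrite fE diffs_inst => /mapP[s sq /esym/eqP].
rewrite mulf_eq0 => /orP[/eqP s0|]; last by case: d d0.
by case/negP: nz; apply/flatten_mapP; exists q; rewrite -?s0.
Qed.

End Family.

(** * Counting differences modulo [m] after replacing the first [k] families *)

Section Count.
Variable h : nat.
Local Notation m := (h.*2.+1).
Hypotheses (h_gt0 : (0 < h)%N) (m3 : ~~ (3 %| m)%N).
Local Open Scope ring_scope.
Local Notation R := ('Z_m).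
Local Notation hits d := (fun z : int => z%:~R == d :> R).

(** A nonzero integer may vanish modulo [m], so the first summand remains even for [d = 0]. *)
Lemma count_nonzero (d : R) (s : seq int) :
  count (hits d) s = (count (hits d) (nonzero s) + (d == 0%R) * count_mem (0 : int) s)%N.
Proof.
elim: s => [|z s]; rewrite /= ?muln0 // => ->; rewrite /nonzero /=.
have [->|_] := eqVneq z 0; last by rewrite !addnA.
by rewrite /= eq_sym; case: (d == 0); lia.
Qed.

(** After exchanging the sums, each slope in [A], with its negative, contributes one by
    [slope_half_system]. *)
Lemma count_family_diffs f i j (d : R) A :
  perm_eq (nonzero (all_diffs f i j template)) (A ++ map -%R A) ->
  all (mem [:: 1; 2; 3]) A ->
  count (hits d) (family_diffs f i j (iota 1 h)) = (size A * (d != 0%R))%N.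
Proof.
move=> pA /allP A123; rewrite /family_diffs count_flatten -map_comp sumnE big_map.
have E (e : nat) : count (hits d) [seq s * e%:Z | s <- nonzero (all_diffs f i j template)]
    = (\sum_(a <- A) (((a * e%:Z)%:~R == d :> R) + ((- a * e%:Z)%:~R == d :> R)))%N.
  rewrite count_map -sum1_count big_mkcond (perm_big _ pA) /= big_cat /= big_map -big_split /=.
  by apply: eq_bigr => a _; do 2!case: (_ == d).
rewrite (eq_bigr _ (fun e _ => E e)) exchange_big /= big_seq.
under eq_bigr => a /A123 aA do rewrite slope_half_system //.
by rewrite -big_seq big_const_seq count_predT iter_addn_0 mulnC.
Qed.

(** Two entries of one fibre collide only if their difference vanishes modulo [m], which is then an
    equality of integers. *)
Lemma placeable_small N B : uniq B -> all (ltn^~ N.+1) (fixeds B) ->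
  (forall i z, z \in diffs i i B -> z%:~R = 0 :> R -> z = 0) -> placeable R N B.
Proof.
move=> uB ltN dB; rewrite /placeable ltN andbT map_inj_in_uniq // => b b' bB b'B.
have fN n : inr n \in B -> (n < N.+1)%N.
  by move=> nB; apply: (allP ltN); rewrite mem_pmap; apply/mapP; exists (inr n).
case: b b' bB b'B => [[i z]|n] [[i' z']|n'] //= bB b'B.
  rewrite !addr0 => -[ii' zz']; rewrite -{i'}ii' in b'B *; congr (inl (_, _)).
  apply/eqP; rewrite -subr_eq0; apply/eqP/(dB i); last by rewrite rmorphB /= zz' subrr.
  apply/allpairsP; exists (z', z); split=> //; rewrite mem_pmap; apply/mapP.
    by exists (inl (i, z')); rewrite //= eqxx.
  by exists (inl (i, z)); rewrite //= eqxx.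
by move=> [/(congr1 val)]; rewrite /= !inordK ?fN // => ->.
Qed.

Section Assembly.
Variables (c o k : nat) (E P : seq nblock).
Hypotheses (adm : admissible c (o + k).+1 k E P) (co : (c <= o.+1)%N) (kh : (k <= h)%N)
  (m10 : (10 < m)%N).

(** These families have infinite points [o + k + 1], ..., [o + h], beyond all fixed points that
    occur in [E] and [P]. *)
Definition tail_blocks : seq nblock :=
  flatten [seq scaled_family o d | d <- iota k.+1 (h - k)].

Lemma mem_tail_blocks q : q \in tail_blocks ->
  exists d q', [/\ (k < d <= h)%N, q' \in template & q = inst_block o d q'].
Proof.
case/flatten_mapP=> d; rewrite mem_iota => dkh /mapP[q' q'T ->].
by exists d, q'; split=> //; lia.
Qed.

Let Q := E ++ tail_blocks.

(** All families 1, ..., h together cover nonzero residues [n] times; exchanging the first [k] for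
    [E] changes the count accordingly. The removed part stands on the left to avoid truncated
    subtraction. *)
Lemma count_all_diffs f i j (d : R) n :
  (forall e q, f (inst_block o e q) = map (inst o e) (f q)) ->
  slopes_ok n (all_diffs f i j template) ->
  (i == j) ==> (d != 0) -> (i != j) ==> (0 \notin all_diffs f i j template) ->
  (count (hits d) (all_diffs f i j Q) + count (hits d) (family_diffs f i j (iota 1 k))
   = n * (d != 0%R) + count (hits d) (nonzero (all_diffs f i j E))
     + (d == 0%R) * count_mem (0 : int) (all_diffs f i j E))%N.
Proof.
move=> fE /and3P[pA A123 /eqP <-] ijd /implyP nz.
have ds0 : all (ltn 0) (iota k.+1 (h - k)) by apply/allP => e; rewrite mem_iota; case: e.
rewrite -(count_family_diffs d pA A123) (_ : iota 1 h = iota 1 k ++ iota k.+1 (h - k)); last first.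
  by rewrite -[k.+1]add1n -iotaD subnKC.
rewrite /family_diffs map_cat flatten_cat count_cat.
rewrite -/(family_diffs _ _ _ _) -/(family_diffs _ _ _ _).
rewrite -(@nonzero_all_diffs_tail f o (iota k.+1 (h - k))) //.
rewrite -/tail_blocks all_diffs_cat count_cat (count_nonzero d (all_diffs f i j E)).
rewrite (count_nonzero d (all_diffs f i j tail_blocks)).
(* Only [d = 0] matters; it forces [i != j], where the tail has no zero difference. *)
suff -> : ((d == 0%R) * count_mem (0 : int) (all_diffs f i j tail_blocks) = 0)%N by lia.
have [d0|_] := eqVneq d 0; last by rewrite mul0n.
rewrite mul1n; apply/count_memPn/zero_notin_tail => //; apply: nz.
by move: ijd; rewrite d0 eqxx implybF.
Qed.

(** Inclusion of multisets of integers passes to counts by residue: [s] is a permutation of a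
    subsequence of [t]. *)
Lemma count_le_of_count_mem a (s t : seq int) :
  all (fun z : int => count_mem z s <= count_mem z t)%N s -> (count a s <= count a t)%N.
Proof.
move=> /allP le; have: (forall z, count_mem z s <= count_mem z t)%N.
  by move=> z; have [/le //|/count_memPn ->] := boolP (z \in s).
by move/count_subseqP => [s' st /permP ->]; apply: leq_count_subseq.
Qed.

Lemma fixeds_tail q : q \in tail_blocks -> fixeds q.2 = [::].
Proof.
case/mem_tail_blocks=> d [q' [_ /(allP template_ok)/and5P[_ _ /eqP f0 _ _] ->]].
by rewrite fixeds_inst f0.
Qed.

Lemma incidences_cat f i n Q1 Q2 :
  incidences f i n (Q1 ++ Q2) = (incidences f i n Q1 + incidences f i n Q2)%N.
Proof. by rewrite /incidences map_cat sumn_cat. Qed.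

Lemma incidences_scaled_family d i n :
  incidences aug i n (scaled_family o d) = (3 * (n == o + d))%N.
Proof.
have /allP/(_ i (mem_fibres i))/eqP <- := template_incidences.
rewrite /incidences /scaled_family -map_comp !sumnE !big_map big_distrl.
rewrite big_seq [RHS]big_seq; apply: eq_bigr => q /(allP template_ok)/and5P[_ _ _ fq _].
rewrite [LHS]/comp [aug (inst_block _ _ _)](_ : _ = map (inst o d) (aug q)) //.
rewrite fixeds_inst coords_inst size_map.
move: fq; rewrite !inE => /orP[] /eqP-> /=; first by rewrite !mul0n.
by rewrite !inE addn0 mul1n mulnC.
Qed.

Lemma incidences_tail i n : incidences aug i n tail_blocks = (3 * (o + k < n <= o + h))%N.
Proof.
have sumE ds : incidences aug i n (flatten [seq scaled_family o d | d <- ds])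
    = (3 * count_mem n [seq o + d | d <- ds])%N.
  elim: ds => // d ds IH; rewrite !map_cons.
  rewrite -[flatten (_ :: _)]/(scaled_family o d ++ flatten _) incidences_cat IH.
  by rewrite incidences_scaled_family -mulnDr /= eq_sym.
rewrite sumE count_uniq_mem ?map_inj_uniq ?iota_uniq //; last exact: addnI.
congr (3 * nat_of_bool _)%N; apply/mapP/andP => [[d]|[]].
  by rewrite mem_iota => dkh ->; lia.
by exists (n - o)%N; rewrite ?mem_iota; lia.
Qed.

Lemma admissible_nesting :
  exists (T : finType) (X Y : {set T}) (A : seq {set T}) (phi : 'I_(size A) -> T),
    [/\ X \subset Y, #|Y| = (3 * m + (o + h).+1)%N,
        is_BIBD (3 * m + c) 3 2 X A & is_weak_nesting 3 2 Y A phi].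
Proof.
case/and5P: adm => /allP okEP /allP okE /allP okP /allP okD /and3P[/allP okI /allP ok2 /allP ok3].
rewrite -(card_residues h_gt0).
have blockEP q : q \in E ++ P ->
    [/\ placeable R (o + h) (aug q), size q.2 = 3%N & all (ltn^~ c) (fixeds q.2)].
  case/okEP/and5P=> uq /eqP s3 ltc /allP ltu /allP small; split=> //.
  apply: placeable_small => // [|i z].
    by apply/allP => n /ltu nu; apply: leq_trans nu _; rewrite ltnS leq_add2l.
  move=> /(allP (small i (mem_fibres i))) le10.
  by apply: (intr_inj_small h_gt0); apply: leq_ltn_trans m10.
have ltu n q : q \in E ++ P -> (o + k < n)%N -> (n \in fixeds (aug q)) = false.
  case/okEP/and5P=> _ _ _ /allP ltu _ un; apply/negbTE/negP => /ltu /=; lia.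
apply: (@develop_nesting _ (o + h) c Q P) => [|q|q|q i||||||].
- by apply: leq_trans co _; rewrite ltnS leq_addr.
- rewrite /Q -catA mem_cat orbC mem_cat -orbA => /or3P[qt|qP|qE].
  + have [d [q' [dkh qT ->]]] := mem_tail_blocks qt.
    have d0 : (0 < d)%N by lia.
    have /and5P[u /eqP s3 /eqP f0 fq /allP sm] := allP template_ok _ qT.
    have augE : aug (inst_block o d q') = map (inst o d) (aug q') by [].
    rewrite /= size_map fixeds_inst f0; split=> //.
    apply: placeable_small.
    * by rewrite augE map_inj_uniq //; apply: inst_inj.
    * rewrite augE fixeds_inst; move: fq; rewrite !inE => /orP[]/eqP-> //=.
      by rewrite andbT; lia.
    move=> i z; rewrite augE diffs_inst => /mapP[s sq ->].
    have /allP/(_ s sq) := sm i (mem_fibres i); rewrite !inE => /or3P[]/eqP ->.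
    + by rewrite mul0r.
    + by apply: (intr_inj_small h_gt0); lia.
    + by apply: (intr_inj_small h_gt0); lia.
  + by apply: blockEP; rewrite mem_cat qP orbT.
  + by apply: blockEP; rewrite mem_cat qE.
- rewrite mem_cat => /orP[/okE //|/mem_tail_blocks[d [q' [_ qT ->]]]].
  have /and5P[_ _ _ fq _] := allP template_ok _ qT.
  rewrite (_ : aug _ = map (inst o d) (aug q')) // fixeds_inst size_map.
  by move: fq; rewrite !inE => /orP[]/eqP->.
- by move/okP/allP/(_ i (mem_fibres i))/eqP.
- move=> i j d ijd; rewrite sum_count_diffs.
  have /allP/(_ i (mem_fibres i))/allP/(_ j (mem_fibres j))/and4P[ok _ nz _] := template_slopes.
  have /allP/(_ j (mem_fibres j))/and3P[/permP eqE _ /implyP z] := okD i (mem_fibres i).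
  (* The count of the replaced families is added to both sides, to cancel against the nonzero
     differences of [E]. *)
  apply: (@addIn (count (hits d) (family_diffs snd i j (iota 1 k)))).
  apply: etrans (@count_all_diffs snd i j d 2 (fun _ _ => erefl) ok ijd nz) _.
  rewrite eqE; have [d0|_] := eqVneq d 0; last by rewrite muln1 mul0n addn0.
  have /z/andP[/eqP -> _] : i != j by move: ijd; rewrite d0 eqxx implybF.
  by rewrite muln0 mul1n addnC.
- move=> i j d ijd; rewrite sum_count_diffs.
  have /allP/(_ i (mem_fibres i))/allP/(_ j (mem_fibres j))/and4P[_ ok _ nz] := template_slopes.
  have /allP/(_ j (mem_fibres j))/and3P[_ leE /implyP z] := okD i (mem_fibres i).
  rewrite -(leq_add2r (count (hits d) (family_diffs aug i j (iota 1 k)))).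
  apply: leq_trans (eq_leq (@count_all_diffs aug i j d 3 (fun _ _ => erefl) ok ijd nz)) _.
  have := count_le_of_count_mem (hits d) leE.
  have [d0|_] := eqVneq d 0; last by rewrite muln1 mul0n addn0 leq_add2l.
  have /z/andP[_ z3] : i != j by move: ijd; rewrite d0 eqxx implybF.
  by rewrite muln0 mul1n add0n addnC; apply: leq_add.
- move=> i j jc; rewrite incidencesE incidences_cat.
  have /andP[/allP/(_ j)] := okI i (mem_fibres i); rewrite mem_iota => /(_ jc)/eqP -> _.
  rewrite -incidencesE big_seq big1 // => q /fixeds_tail ->.
  by rewrite in_nil mul0n.
- move=> i j jN; rewrite incidencesE incidences_cat incidences_tail.
  have [ju|uj] := leqP j (o + k).
    have /andP[_ /allP/(_ j)] := okI i (mem_fibres i); rewrite mem_iota => /(_ ju).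
    by rewrite addn0.
  (* Beyond [o + k] only the tail contributes, 3 or 0. *)
  rewrite -incidencesE big_seq big1 ?add0n => [|q qE]; first by case: (_ && _).
  by rewrite ltu ?mem_cat ?qE // mul0n.
- move=> j j' jc j'c ne; apply/eqP.
  have /ok2/allP/(_ j') : j \in iota 0 c by rewrite mem_iota.
  by rewrite mem_iota => /(_ j'c); rewrite ne.
- move=> j j' ne.
  have [jj'|] := boolP ((j <= o + k) && (j' <= o + k))%N.
    case/andP: jj' => ju j'u; have /ok3/allP/(_ j') : j \in iota 0 (o + k).+1 by rewrite mem_iota.
    by rewrite mem_iota => /(_ j'u); rewrite ne.
  rewrite negb_and -!ltnNge => out; rewrite (@eq_in_count _ _ pred0) ?count_pred0 // => q qP /=.
  by case/orP: out => u_lt; rewrite (ltu _ _ _ u_lt) ?andbF // mem_cat qP orbT.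
Qed.

End Assembly.
End Count.

(** * The two explicit sets of base blocks, and the theorem *)

Section Instances.
Local Open Scope ring_scope.
Local Notation p i z := (inl (i, z%Z) : bpoint).

(** Each group with the fixed point 0 carries all four of its triples, a (4,3,2)-BIBD. Nesting both
    kinds of blocks for [d = 1] with infinite points frees the differences 1 and -1 for nesting the
    triples through 0. *)
Definition one_fixed_blocks : seq nblock :=
  (inr 2%N, [:: p fib0 0; p fib1 0; p fib2 0]) ::
  flatten [seq
    [:: (p ijk.2 1, [:: inr 0%N; p ijk.1.1 0; p ijk.1.2 0]);
        (inr 1%N, [:: p ijk.1.1 1; p ijk.1.1 (-1); p ijk.1.2 2]);
        (inr 3%N, [:: p ijk.1.1 1; p ijk.1.1 (-1); p ijk.1.2 (-2)])]
    | ijk <- [:: (fib0, fib1, fib2); (fib1, fib2, fib0); (fib2, fib0, fib1)]].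

Lemma admissible_one_fixed : admissible 1 4 1 one_fixed_blocks [::].
Proof. by vm_compute. Qed.

(* Found by computer search: [(n, i, j, z, p)] stands for the block [{n, 0_i, z_j}] nested with
[p]. Their differences are those of the family for [d = 4], plus one zero for each pair of
fibres. *)
Definition pair_blocks : seq (nat * 'I_3 * 'I_3 * int * ('I_3 * int)) :=
  [:: (0%N, fib0, fib0, 8%Z, (fib0, 6%Z));
      (0%N, fib1, fib1, 8%Z, (fib1, 2%Z));
      (0%N, fib2, fib2, 8%Z, (fib2, 2%Z));
      (1%N, fib0, fib0, 8%Z, (fib2, 3%Z));
      (1%N, fib1, fib2, 0%Z, (fib0, -1%Z));
      (1%N, fib1, fib2, 12%Z, (fib1, 8%Z));
      (2%N, fib0, fib1, 0%Z, (fib2, 2%Z));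
      (2%N, fib0, fib1, -4%Z, (fib1, 0%Z));
      (2%N, fib2, fib2, 8%Z, (fib0, 3%Z));
      (3%N, fib0, fib1, 4%Z, (fib2, -1%Z));
      (3%N, fib1, fib2, -4%Z, (fib0, -4%Z));
      (3%N, fib2, fib0, 0%Z, (fib1, -5%Z));
      (4%N, fib0, fib1, 12%Z, (fib1, 2%Z));
      (4%N, fib1, fib2, 4%Z, (fib2, 0%Z));
      (4%N, fib2, fib0, -12%Z, (fib0, -4%Z));
      (5%N, fib0, fib1, -12%Z, (fib0, -10%Z));
      (5%N, fib1, fib2, -12%Z, (fib2, -4%Z));
      (5%N, fib2, fib0, 4%Z, (fib1, 3%Z));
      (6%N, fib1, fib1, 8%Z, (fib0, 3%Z));
      (6%N, fib2, fib0, -4%Z, (fib1, -1%Z));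
      (6%N, fib2, fib0, 12%Z, (fib2, 10%Z))].

(** The families for [d] = 1, 2, 3, 5 keep their blocks but are nested with infinite points only;
    the differences so freed serve the fibre points that nest the other developed blocks. The family
    for [d = 4] gives way to [pair_blocks]. *)
Definition seven_fixed_blocks : seq nblock :=
  (p fib0 4, [:: p fib0 0; p fib1 0; p fib2 0]) ::
  [seq (inl x.2, [:: inr x.1.1.1.1; p x.1.1.1.2 0; inl (x.1.1.2, x.1.2)]) | x <- pair_blocks] ++
  flatten [seq
    [:: (inr du.2, [:: p ij.1 du.1; p ij.1 (- du.1); p ij.2 (2 * du.1)]);
        (inr du.2.+1, [:: p ij.1 du.1; p ij.1 (- du.1); p ij.2 (- 2 * du.1)])]
    | ij <- [:: (fib0, fib1); (fib1, fib2); (fib2, fib0)],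
      du <- [:: (1%Z, 7%N); (2%Z, 9%N); (3%Z, 11%N); (5%Z, 13%N)]].

(** The lines come from the difference set {0, 1, 3} modulo 7. Each copy of the plane has its own
    infinite point, which meets each point 3 times. *)
Definition fano_blocks : seq nblock :=
  [seq (inr n, [:: inr i; inr ((i + 1) %% 7)%N; inr ((i + 3) %% 7)%N])
    | n <- [:: 7; 8]%N, i <- iota 0 7].

Lemma admissible_seven_fixed : admissible 7 15 5 seven_fixed_blocks fano_blocks.
Proof. by vm_compute. Qed.
End Instances.

Theorem theorem3p6 (t : nat) : 2 <= t ->
  exists (T : finType) (X Y : {set T}) (A : seq {set T}) (phi : 'I_(size A) -> T),
    [/\ X \subset Y, #|Y| = 14 * t + 13,
        is_BIBD (12 * t + 10) 3 2 X A &
        is_weak_nesting 3 2 Y A phi].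
Proof.
move=> t2; have [t3|t3] := boolP (3 %| t).
  (* Here [h = 2t] and [o = 9]; from [t >= 3] follow [5 <= h] and [10 < 4t + 1]. *)
  have -> : 14 * t + 13 = 3 * (2 * t).*2.+1 + (9 + 2 * t).+1 by lia.
  have -> : 12 * t + 10 = 3 * (2 * t).*2.+1 + 7 by lia.
  apply: (@admissible_nesting _ _ _ 7 9 5 _ _ admissible_seven_fixed); lia.
(* Here [h = 2t + 1] and [o = 2]; the bound [10 < 4t + 3] needs [t >= 2]. *)
have -> : 14 * t + 13 = 3 * (2 * t).+1.*2.+1 + (2 + (2 * t).+1).+1 by lia.
have -> : 12 * t + 10 = 3 * (2 * t).+1.*2.+1 + 1 by lia.
apply: (@admissible_nesting _ _ _ 1 2 1 _ _ admissible_one_fixed); lia.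
Qed.
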